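(* Let $G$ be a finite simple graph with at least one vertex, let $C$ be the set of cheap vertices of $G$, and let $S$ be any maximal independent subset of $G[C]$. Let $B$ be the bipartite graph with partite sets $S$ and $N(S)$ whose edges are all edges of $G$ between $S$ and $N(S)$, and let $B_1,\dots,B_p$ be the connected components of $B$. For each $i$ let $e_i$ be the number of edges of $B_i$, $s_i=|V(B_i)\cap S|$, $t_i=|V(B_i)\cap N(S)|$, and $\lambda_i=1-\frac{e_i}{s_i}+\frac{t_i}{s_i}$. Suppose $\lambda_i\geq 0$ for all $i$. Then $$\alpha(G)\geq \sum_{i=1}^p\ \sum_{v\in N[S\cap V(B_i)]}\frac{1}{\zeta(v)+\lambda_i}+\sum_{v\in V(G)\setminus N[S]}\frac{1}{\zeta(v)+1}.$$
   Context: $\alpha(G)$ is the independence number. For a vertex $v$, $\zeta(v)=\max_H\delta(H)$, the maximum over all subgraphs $H$ of $G$ containing $v$, where $\delta(H)$ is the minimum degree of $H$. For $X\subseteq V(G)$, $N(X)=\bigcup_{v\in X}N(v)$ and $N[X]=N(X)\cup X$; $G[X]$ is the induced subgraph. A vertex $u$ is cheap if $\zeta(u)=\deg_G(u)$ and $\zeta(u)=\min_{v\in N[u]}\zeta(v)$. *)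

(* Defs.v *)
(* A finite simple graph is a symmetric irreflexive relation
   [e : rel T] on a finite type [T] of vertices. *)
From mathcomp Require Import all_boot all_order all_algebra.

Set Implicit Arguments.
Unset Strict Implicit.
Unset Printing Implicit Defensive.

Section Graph.
Variable T : finType.
Implicit Types (e : rel T) (v : T) (X S P : {set T}).

Definition nbh e v : {set T} := [set w | e v w].
Definition deg e v : nat := #|nbh e v|.

Definition open_nbh e X : {set T} := \bigcup_(v in X) nbh e v.
Definition closed_nbh e X : {set T} := open_nbh e X :|: X.

(* Restricting adjacency to X isolates the vertices outside X instead of
   removing them: the vertex set X of G[X] has to be tracked separately. *)
Definition induced e X : rel T := [rel x y | [&& x \in X, y \in X & e x y]].

Definition edges e : {set {set T}} :=
  [set [set p.1; p.2] | p : T * T & e p.1 p.2].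

Definition independent e X : bool := [forall x in X, forall y in X, ~~ e x y].

Definition alpha e : nat := \max_(X : {set T} | independent e X) #|X|.

(* An arbitrary (not necessarily induced) subgraph is a pair of a vertex set
   and an edge set, the latter being a symmetric set of ordered pairs. *)
Definition is_subgraph e (H : {set T} * {set T * T}) : bool :=
  [forall x, forall y, ((x, y) \in H.2) ==>
     [&& (y, x) \in H.2, x \in H.1, y \in H.1 & e x y]].

(* The default value #|T| of the minimum exceeds every degree of a simple
   graph on T, so it only shows up when H has no vertex. *)
Definition min_degree (H : {set T} * {set T * T}) : nat :=
  \big[minn/#|T|]_(u in H.1) #|[set w | (u, w) \in H.2]|.

Definition zeta e v : nat :=
  \max_(H : {set T} * {set T * T} | is_subgraph e H && (v \in H.1))
     min_degree H.

(* Again #|T| is a harmless default: zeta is smaller than #|T| in a simple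
   graph and N[u] contains u. *)
Definition cheap e v : bool :=
  (zeta e v == deg e v) &&
  (zeta e v == \big[minn/#|T|]_(w in closed_nbh e [set v]) zeta e w).

Definition cheap_set e : {set T} := [set v | cheap e v].

Definition max_indep_in e X S : bool :=
  maxset (fun A : {set T} => (A \subset X) && independent (induced e X) A) S.

Definition bip e S : rel T :=
  [rel x y | e x y && ((x \in S) && (y \in open_nbh e S) ||
                       (x \in open_nbh e S) && (y \in S))].

(* The vertex sets of the connected components of the bipartite graph. *)
Definition components e S : {set {set T}} :=
  equivalence_partition (connect (bip e S)) (S :|: open_nbh e S).

Local Open Scope ring_scope.

(* The denominator is nonzero: every component contains a vertex of S. *)
Definition lambda e S P : rat :=
  let ei := #|edges (induced (bip e S) P)| in
  let si := #|P :&: S| in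
  let ti := #|P :&: open_nbh e S| in
  1 - ei%:R / si%:R + ti%:R / si%:R.

End Graph.

(* Main.v *)
Require Import Defs.
From mathcomp Require Import all_boot all_order all_algebra.
From mathcomp Require Import ring lra.

Set Implicit Arguments.
Unset Strict Implicit.
Unset Printing Implicit Defensive.

Import Order.TTheory GRing.Theory Num.Theory.
Local Open Scope ring_scope.

(* Since alpha(G) >= |S| + alpha(G - N[S]), the vertices outside N[S] are
   handled by the greedy bound alpha >= sum 1/(zeta + 1), and it remains to show
   that a component P with s vertices in S satisfies
   sum_(v in P) 1/(zeta v + lambda) <= s.
   For v in P let L(v) be deg v if v is in S, and the largest degree of a
   neighbour of v in S otherwise; as S is cheap, L <= zeta. Give the vertices u
   of S the charge deg u + lambda - 1 and the others the charge -1. The claim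
   becomes sum_v charge(v) / (L(v) + lambda) >= 0, where the total charge is 0
   by the choice of lambda. By summation by parts it suffices that every
   superlevel set of L has charge <= 0. Such a set is U + N(U) with U included
   in S, and its charge is (edges - vertices) + lambda |U|. Growing a subgraph
   of a connected graph never decreases edges - vertices, so this is at most
   - lambda s + lambda |U| <= 0. *)

(* Summation by parts along the levels of d. The hypothesis is on the product,
   so w need not decrease at levels k that carry no charge. *)
Lemma sum_mul_level_ge0 (R : realFieldType) (I : finType) (A : {set I})
    (c : I -> R) (d : I -> nat) (w : nat -> R) :
    \sum_(i in A) c i = 0 ->
    (forall k, 0 <= (w k - w k.+1) * \sum_(i in A | (d i <= k)%N) c i) ->
  0 <= \sum_(i in A) c i * w (d i).
Proof.
move=> c0 wc; pose M := \max_(i in A) d i.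
(* Telescoping from [j] up to [n]. With [n] equal to [M], the constant [w M] gets multiplied by the
   total of [c], which is 0. *)
have wE n j : (j <= n)%N ->
    w j = w n + \sum_(k < n | (j <= k)%N) (w k - w k.+1).
  elim: n => [|n IHn]; first by rewrite leqn0 => /eqP->; rewrite big_ord0 addr0.
  rewrite big_mkcond big_ord_recr -big_mkcond /= leq_eqVlt ltnS.
  case/predU1P => [->|jn]; last by rewrite jn {1}IHn //; ring.
  rewrite ltnn big1 ?addr0 // => k /leq_trans/(_ (ltnW (ltn_ord k))).
  by rewrite ltnn.
under eq_bigr => i iA do
  rewrite (wE M (d i)) ?leq_bigmax_cond // mulrDr mulr_sumr.
rewrite big_split /= -mulr_suml c0 mul0r add0r.
rewrite (exchange_big_dep predT) //=.
apply: sumr_ge0 => k _; rewrite -mulr_suml mulrC; exact: wc.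
Qed.

(** * Bounds on minima with a default value *)

Section Minimum.
Variables (I : finType) (m : nat) (F : I -> nat) (P : pred I).

Lemma leq_bigminn n : (n <= m)%N -> (forall i, P i -> (n <= F i)%N) ->
  (n <= \big[minn/m]_(i | P i) F i)%N.
Proof.
by move=> nm nF; elim/big_ind: _ => // x y; rewrite leq_min => -> ->.
Qed.

Lemma bigminn_leq i : P i -> (\big[minn/m]_(i | P i) F i <= F i)%N.
Proof. by move=> Pi; apply: (@bigmin_le_cond _ nat). Qed.

End Minimum.

(** * Lower bounds on [zeta] and the greedy independent set *)

Section Graph.
Variables (T : finType) (e : rel T).
Hypotheses (e_sym : symmetric e) (e_irr : irreflexive e).

Lemma open_nbhP (X : {set T}) (v : T) :
  reflect (exists2 u, u \in X & e u v) (v \in open_nbh e X).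
Proof.
by apply: (iffP bigcupP) => -[u uX]; rewrite ?inE => uv; exists u; rewrite ?inE.
Qed.

(** The subgraph induced by [X] competes in the maximum defining [zeta]; [k <= #|T|] takes care of
    the default value in [min_degree]. *)
Lemma zeta_ge_induced (X : {set T}) (k : nat) (v : T) :
    (k <= #|T|)%N -> (forall x, x \in X -> (k <= #|nbh e x :&: X|)%N) ->
  v \in X -> (k <= zeta e v)%N.
Proof.
move=> kT kX vX.
pose H := (X, [set p : T * T | [&& p.1 \in X, p.2 \in X & e p.1 p.2]]).
have subH : is_subgraph e H && (v \in H.1).
  rewrite vX andbT; apply/forallP => x; apply/forallP => y; apply/implyP.
  by rewrite !inE /= => /and3P[-> -> xy]; rewrite e_sym xy.
apply: leq_trans (@leq_bigmax_cond _ _ (@min_degree T) _ subH).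
apply: leq_bigminn => // u uX; apply: leq_trans (kX u uX) _.
apply: subset_leq_card; apply/subsetP => w; rewrite !inE => /andP[uw wX].
by rewrite /= uX wX.
Qed.

(* The greedy algorithm: a vertex of minimum degree k in e[X] has, together
   with its neighbours, k + 1 vertices, all of zeta at least k. *)
Lemma exists_independent_zeta (X : {set T}) :
  exists2 I : {set T}, (I \subset X) && independent e I
    & \sum_(v in X) 1 / ((zeta e v)%:R + 1) <= #|I|%:R :> rat.
Proof.
have [n] := ubnP #|X|; elim: n X => // n IHn X; rewrite ltnS => Xn.
have [->|[x0 x0X]] := set_0Vmem X.
  exists set0; last by rewrite big_set0.
  by rewrite sub0set; apply/forall_inP => x; rewrite inE.
case: (arg_minnP (fun x => #|nbh e x :&: X|) x0X) => u uX_ umin.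
have {uX_} uX : u \in X := uX_.
set k := #|nbh e u :&: X| in umin; pose N := u |: (nbh e u :&: X).
have NX : N \subset X by rewrite subUset sub1set uX subsetIr.
have uN : u \in N by rewrite setU11.
have kT : (k <= #|T|)%N by apply: max_card.
have zk v : v \in X -> (k <= zeta e v)%N by apply: zeta_ge_induced kT umin.
have [|I /andP[IX Iind] sumI] := IHn (X :\: N).
  apply: leq_trans Xn; apply: proper_card; rewrite properE subsetDl.
  by apply/subsetPn; exists u; rewrite // inE uN.
have uI : u \notin I by apply/negP => /(subsetP IX); rewrite inE uN.
have nuI v : v \in I -> ~~ e u v.
  move=> /(subsetP IX); rewrite !inE negb_or => /andP[/andP[_ H] vX].
  by apply: contra H => ->.
exists (u |: I).
  rewrite subUset sub1set uX (subset_trans IX) ?subsetDl //=.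
  apply/forall_inP => x /setU1P[->|xI]; apply/forall_inP => y /setU1P[->|yI].
  - by rewrite e_irr.
  - exact: nuI.
  - by rewrite e_sym nuI.
  - by move/forall_inP: Iind => /(_ x xI)/forall_inP/(_ y yI).
rewrite (big_setID N) /= (setIidPr NX) cardsU1 uI natrD lerD //.
apply: (@le_trans _ _ (\sum_(v in N) 1 / (k%:R + 1))).
  apply: ler_sum => v vN; rewrite !div1r lef_pV2 ?posrE ?ltr_wpDl //.
  by rewrite lerD2r ler_nat zk // (subsetP NX).
have Nk : #|N| = k.+1 by rewrite cardsU1 !inE e_irr.
rewrite sumr_const Nk -[_ *+ k.+1]mulr_natr -natr1 div1r mulVf //.
by rewrite lt0r_neq0 ?ltr_wpDl.
Qed.

Lemma cheap_leq_zeta (u v : T) : cheap e u -> e u v -> (deg e u <= zeta e v)%N.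
Proof.
case/andP=> /eqP <- /eqP-> uv; apply: bigminn_leq.
by rewrite inE; apply/orP; left; apply/open_nbhP; exists u; rewrite ?inE.
Qed.

(** * Components of the bipartite graph *)

Section Components.
Variable S : {set T}.
Hypothesis S_ind : independent e S.

Lemma open_nbh_notin v : v \in open_nbh e S -> v \notin S.
Proof.
case/open_nbhP => u uS uv; apply/negP => vS.
by move/forall_inP: S_ind => /(_ u uS)/forall_inP/(_ v vS); rewrite uv.
Qed.

(** An edge with one end in [S] automatically has its other end in [open_nbh e S]. *)
Lemma bipE x y : bip e S x y = e x y && ((x \in S) || (y \in S)).
Proof.
rewrite /bip /=; have [xy|//] := boolP (e x y); rewrite /=.
have [xS|xS] /= := boolP (x \in S).
  by apply/orP; left; apply/open_nbhP; exists x.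
have [yS|yS] /= := boolP (y \in S); last by rewrite andbF.
by rewrite andbT; apply/open_nbhP; exists y; rewrite // e_sym.
Qed.

Lemma bip_sym : symmetric (bip e S).
Proof. by move=> x y; rewrite !bipE e_sym orbC. Qed.

Lemma components_partition : partition (components e S) (S :|: open_nbh e S).
Proof.
apply: equivalence_partitionP => x y z _ _ _; split; first exact: connect0.
by move=> xy; rewrite (same_connect _ xy) //; apply: sym_connect_sym bip_sym.
Qed.

Section Component.
Variable P : {set T}.
Hypothesis PB : P \in components e S.

Lemma component_connect x y : x \in P -> y \in P -> connect (bip e S) x y.
Proof.
case/imsetP: PB => z _ ->; rewrite !inE => /andP[_ zx] /andP[_].
by apply: connect_trans; rewrite (sym_connect_sym bip_sym).
Qed.

Lemma component_edge x y :
  x \in P -> e x y -> (x \in S) || (y \in S) -> y \in P.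
Proof.
move=> xP xy xyS; have bxy : bip e S x y by rewrite bipE xy.
case/imsetP: PB xP => z _ ->; rewrite !inE => /andP[_ zx].
rewrite (connect_trans zx (connect1 bxy)) andbT.
have [//|yS] := boolP (y \in S); apply/open_nbhP; exists x => //.
by move: xyS; rewrite (negPf yS) orbF.
Qed.

Lemma component_sub : P \subset S :|: open_nbh e S.
Proof.
by rewrite -(cover_partition components_partition); apply: bigcup_sup PB.
Qed.

(** This lets the inner sums of the theorem range over [P] itself. *)
Lemma component_closed_nbh : closed_nbh e (S :&: P) = P.
Proof.
apply/setP => v; rewrite inE; apply/orP/idP => [[]|vP].
- case/open_nbhP => u /setIP[uS uP] uv.
  by apply: component_edge uP uv _; rewrite uS.
- by case/setIP.
have [vS|] := boolP (v \in S); first by right; apply/setIP.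
move: (subsetP component_sub v vP); rewrite inE => /orP[-> //|].
case/open_nbhP => u uS uv _; left; apply/open_nbhP; exists u => //.
apply/setIP; split=> //; apply: component_edge vP _ _; first by rewrite e_sym.
by rewrite uS orbT.
Qed.

Lemma component_open_nbh : P :\: S = open_nbh e (S :&: P).
Proof.
apply/setP => v; rewrite -{1}component_closed_nbh !inE.
have [vS|vS] /= := boolP (v \in S); last by rewrite orbF.
apply/esym/negP => /open_nbhP[u /setIP[uS _] uv].
suff: v \notin S by rewrite vS.
by apply: open_nbh_notin; apply/open_nbhP; exists u.
Qed.

Lemma component_neq0 : S :&: P != set0.
Proof.
have : P != set0.
  by apply: contraL PB => /eqP ->; case/and3P: components_partition.
apply: contra => /eqP SP0; rewrite -component_closed_nbh SP0 /closed_nbh setU0.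
by apply/eqP/setP => v; rewrite inE; apply/open_nbhP => -[u]; rewrite inE.
Qed.

(** Otherwise [U] and its neighbours form a set closed under [bip], which by connectivity contains a
    vertex of [S :&: P] outside [U]. That vertex would be a neighbour of [U], against the
    independence of [S]. *)
Lemma component_expand (U : {set T}) : U \proper S :&: P -> U != set0 ->
  exists2 u, u \in (S :&: P) :\: U & nbh e u :&: open_nbh e U != set0.
Proof.
case/properP=> US [x1 x1SP x1U] /set0Pn[x0 x0U].
have [/exists_inP[]|] :=
  boolP [exists u in (S :&: P) :\: U, nbh e u :&: open_nbh e U != set0].
  by move=> u; exists u.
rewrite negb_exists => /forallP noexp.
have clU : closed (bip e S) [in U :|: open_nbh e U].
  apply: intro_closed; first exact: (sym_connect_sym bip_sym).
  move=> x y; rewrite bipE => /andP[xy xyS]; rewrite !inE => /orP[xU|].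
    by apply/orP; right; apply/open_nbhP; exists x.
  case/open_nbhP => u uU ux; have /setIP[uS uP] := subsetP US u uU.
  have xNS : x \in open_nbh e S by apply/open_nbhP; exists u.
  have yS : y \in S by move: xyS; rewrite (negPf (open_nbh_notin xNS)).
  have xP : x \in P by apply: component_edge uP ux _; rewrite uS.
  have yP : y \in P by apply: component_edge xP xy xyS.
  (* If [y] were outside [U], the vertex [x] would lie in the intersection that [noexp] declares
     empty. *)
  move: (noexp y); rewrite !inE yS yP andbT; case: (y \in U) => //= /negPn/eqP.
  move/setP/(_ x); rewrite !inE e_sym xy /= => /open_nbhP[].
  by exists u.
have /setIP[x1S x1P] := x1SP.
have /setIP[_ x0P] := subsetP US _ x0U.
have := closed_connect clU (component_connect x0P x1P).
rewrite !inE x0U /= (negPf x1U) /= => /esym/open_nbhP[u uU ux1].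
have /setIP[uS _] := subsetP US u uU.
suff: x1 \notin S by rewrite x1S.
by apply: open_nbh_notin; apply/open_nbhP; exists u.
Qed.

(* Edges minus vertices of the subgraph of the bipartite graph spanned by U
   and its neighbourhood. *)
Definition excess (U : {set T}) : rat :=
  \sum_(u in U) ((deg e u)%:R - 1) - #|open_nbh e U|%:R.

(* Adding to U a vertex u of S that has a neighbour in N(U) adds deg u edges
   and at most deg u vertices. *)
Lemma excess_le (U : {set T}) : U \subset S :&: P -> U != set0 ->
  excess U <= excess (S :&: P).
Proof.
have [n] := ubnP #|(S :&: P) :\: U|; elim: n U => // n IHn U; rewrite ltnS.
move=> Un US U0; have [->//|neqU] := eqVneq U (S :&: P).
have [|u uSP /set0Pn[v vu]] := @component_expand U _ U0.
  by rewrite properEneq neqU.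
have [uSP' uU] := setDP uSP.
have U'S : u |: U \subset S :&: P by rewrite subUset sub1set uSP'.
apply: (@le_trans _ _ (excess (u |: U))); last first.
  apply: IHn => //; last by apply/set0Pn; exists u; rewrite setU11.
  apply: leq_trans Un; apply: proper_card; apply/properP; split.
    by apply: setDS; apply: subsetUr.
  by exists u; rewrite // in_setD setU11.
rewrite /excess big_setU1 //= /open_nbh bigcup_setU big_set1 -!/(open_nbh _ _).
have cardE := cardsUI (nbh e u) (open_nbh e U).
(* The shared neighbour saves one vertex, which pays for [u] itself. *)
have cap : (0 < #|nbh e u :&: open_nbh e U|)%N by apply/card_gt0P; exists v.
move/(congr1 (fun k : nat => k%:R : rat)): cardE; rewrite !natrD -/(deg e u).
move: cap; rewrite -(ler_nat rat); lra.
Qed.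

(** Each edge has exactly one end in [S], so it can be counted as an ordered pair starting there. *)
Lemma card_component_edges :
  #|edges (induced (bip e S) P)| = (\sum_(u in S :&: P) deg e u)%N.
Proof.
pose A := [set p : T * T | (p.1 \in S :&: P) && e p.1 p.2].
have AE p : p \in A -> (p.1 \in S) && (p.2 \notin S).
  rewrite !inE => /andP[/andP[pS pP] pe]; rewrite pS /=.
  by apply: open_nbh_notin; apply/open_nbhP; exists p.1.
have -> : edges (induced (bip e S) P) = [set [set p.1; p.2] | p in A].
  apply/setP => E; apply/imsetP/imsetP => -[[x y]].
    rewrite inE /induced /= => /and3P[xP yP]; rewrite bipE.
    case/andP=> xy; have [xS _|xS /= yS] := boolP (x \in S); move=> ->.
      by exists (x, y); rewrite // inE /= inE xS xP.
    by exists (y, x); [rewrite inE /= inE yS yP e_sym | rewrite setUC].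
  rewrite !inE /= => /andP[/andP[xS xP] xy] ->; exists (x, y) => //.
  rewrite inE /induced /= xP bipE xy xS /= andbT.
  by apply: component_edge xP xy _; rewrite xS.
rewrite card_in_imset; last first.
  move=> [x y] [x' y'] /AE /= /andP[xS yS] /AE /= /andP[x'S y'S] eqE.
  have : x \in [set x'; y'] by rewrite -eqE set21.
  have : y \in [set x'; y'] by rewrite -eqE set22.
  rewrite !inE => /orP[]/eqP yE /orP[]/eqP xE; subst=> //.
  - by rewrite x'S in yS.
  - by rewrite x'S in yS.
  - by rewrite xS in y'S.
under eq_bigr => u _ do rewrite /deg -sum1_card.
rewrite pair_big_dep sum1dep_card; apply: eq_card => -[x y].
by rewrite !inE.
Qed.

(** Clearing the denominator in [lambda] leaves vertices minus edges of the component. *)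
Lemma lambda_excess : lambda e S P * #|S :&: P|%:R = - excess (S :&: P).
Proof.
have s0 : #|S :&: P|%:R != 0 :> rat.
  by rewrite pnatr_eq0 cards_eq0 component_neq0.
have tE : P :&: open_nbh e S = open_nbh e (S :&: P).
  rewrite -component_open_nbh; apply/setP => v; rewrite !inE.
  have [vP|] := boolP (v \in P); last by rewrite andbF.
  rewrite andbT; apply/idP/idP => [/open_nbh_notin //|vS].
  by move: (subsetP component_sub v vP); rewrite inE (negPf vS).
rewrite /lambda tE card_component_edges setIC -/(S :&: P) /excess.
rewrite setIC in s0 *; rewrite sumrB sumr_const natr_sum.
by field.
Qed.

(** * Charges and the bound for one component *)

Hypothesis S_cheap : S \subset cheap_set e.
Hypothesis lambda_ge0 : 0 <= lambda e S P.

Local Notation lam := (lambda e S P).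

(** Only an isolated [u] is at issue: it cannot be expanded, so it is all of [S :&: P], the excess
    is -1 and [lam] is 1. *)
Lemma deg_lambda_gt0 u : u \in S :&: P -> 0 < (deg e u)%:R + lam.
Proof.
move=> uSP; have [d0|] := posnP (deg e u); last first.
  by move=> d0; rewrite ltr_wpDr // ltr0n.
have N0 : nbh e u = set0 by apply: cards0_eq.
have ON : open_nbh e [set u] = set0 by rewrite /open_nbh big_set1.
have [SPE|neq] := eqVneq [set u] (S :&: P).
  have := lambda_excess; rewrite -SPE /excess big_set1 ON d0 cards0 cards1.
  lra.
have [||u' _] := @component_expand [set u].
- by rewrite properEneq neq sub1set.
- by apply/set0Pn; exists u; rewrite set11.
by rewrite ON setI0 eqxx.
Qed.

Let level v :=
  if v \in S then deg e v else (\max_(u in S :&: P | e u v) deg e u)%N.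

Let charge v : rat := if v \in S then (deg e v)%:R + lam - 1 else -1.

Lemma sum_charge (U : {set T}) : U \subset S :&: P ->
  \sum_(v in closed_nbh e U) charge v = excess U + lam * #|U|%:R.
Proof.
move=> US; have notS v : v \in open_nbh e U -> v \notin S.
  case/open_nbhP => u /(subsetP US)/setIP[uS _] uv.
  by apply: open_nbh_notin; apply/open_nbhP; exists u.
have inS u : u \in U -> u \in S by move=> /(subsetP US)/setIP[].
rewrite (big_setID U) /= /closed_nbh (setIidPr _) ?subsetUr //.
have -> : (open_nbh e U :|: U) :\: U = open_nbh e U.
  apply/setP => v; rewrite !inE; have [vU|_] /= := boolP (v \in U).
    by apply/esym/negP => /notS; rewrite inS.
  by rewrite orbF.
under eq_bigr => v vU do rewrite /charge inS //.
under [X in _ + X]eq_bigr => v vU do rewrite /charge (negPf (notS v vU)).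
under eq_bigr do rewrite -addrA [lam - 1]addrC addrA.
rewrite big_split /= !sumr_const /excess mulNrn mulr_natr.
by rewrite addrAC.
Qed.

Lemma level_lambda_gt0 v : v \in P -> 0 < (level v)%:R + lam.
Proof.
move=> vP; rewrite /level; have [vS|vS] := boolP (v \in S).
  by apply: deg_lambda_gt0; rewrite inE vS.
have : v \in open_nbh e (S :&: P) by rewrite -component_open_nbh inE vS.
case/open_nbhP => u uSP uv; apply: lt_le_trans (deg_lambda_gt0 uSP) _.
by rewrite lerD2r ler_nat leq_bigmax_cond // uSP.
Qed.

Lemma level_leq_zeta v : v \in P -> (level v <= zeta e v)%N.
Proof.
have cheapS u : u \in S -> cheap e u by move/(subsetP S_cheap); rewrite inE.
move=> vP; rewrite /level; have [vS|vS] := boolP (v \in S).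
  by have /andP[/eqP <-] := cheapS v vS.
apply/bigmax_leqP => u /andP[/setIP[uS _] uv].
by apply/cheap_leq_zeta/uv/cheapS.
Qed.

Lemma sum_component_le :
  \sum_(v in closed_nbh e (S :&: P)) 1 / ((zeta e v)%:R + lam)
    <= #|S :&: P|%:R.
Proof.
pose w (k : nat) : rat := (k%:R + lam)^-1.
rewrite component_closed_nbh.
apply: (@le_trans _ _ (\sum_(v in P) w (level v))).
  apply: ler_sum => v vP; have lv := level_lambda_gt0 vP.
  have lz : (level v)%:R + lam <= (zeta e v)%:R + lam.
    by rewrite lerD2r ler_nat level_leq_zeta.
  by rewrite div1r lef_pV2 // posrE // (lt_le_trans lv).
rewrite -subr_ge0.
(* The charges are chosen for this: the indicator of [S] minus [w (level v)] equals
   [charge v * w (level v)]. *)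
have -> : #|S :&: P|%:R - \sum_(v in P) w (level v)
        = \sum_(v in P) charge v * w (level v).
  rewrite -sum1_card natr_sum [X in X - _](_ : _ = \sum_(v in P) (v \in S)%:R).
    rewrite -sumrB; apply: eq_bigr => v vP; have := level_lambda_gt0 vP.
    rewrite /charge /w /level; case: (v \in S) => [d0|_].
      by rewrite mulrBl mulfV ?mul1r // lt0r_neq0.
    by rewrite sub0r mulN1r.
  rewrite big_mkcond [RHS]big_mkcond; apply: eq_bigr => v _.
  by rewrite inE; case: (v \in S); case: (v \in P).
have tot : \sum_(v in P) charge v = 0.
  rewrite -{1}component_closed_nbh sum_charge // lambda_excess.
  by rewrite subrr.
apply: sum_mul_level_ge0 => // k.
pose U := [set u in S :&: P | (k < deg e u)%N].
have US : U \subset S :&: P by apply/subsetP => u; rewrite inE => /andP[].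
(* The vertices of level above [k] are exactly [closed_nbh e U]; since the total charge is 0, the
   remaining ones carry the opposite charge. *)
have pre : \sum_(v in P | (level v <= k)%N) charge v
         = - (excess U + lam * #|U|%:R).
  rewrite -sum_charge //; apply/eqP; rewrite -addr_eq0; apply/eqP.
  rewrite -[RHS]tot.
  rewrite [RHS](bigID (fun v => (level v <= k)%N)) /=; congr (_ + _).
  apply: eq_bigl => v; rewrite -ltnNge -{1}component_closed_nbh !inE /level.
  have [vS|vS] := boolP (v \in S).
    have nO (X : {set T}) : X \subset S -> (v \in open_nbh e X) = false.
      move=> XS; apply/negP => /open_nbhP[u uX uv].
      suff : v \notin S by rewrite vS.
      by apply/open_nbh_notin/open_nbhP; exists u; rewrite ?(subsetP XS).
    by rewrite !nO ?subsetIl ?(subset_trans US) ?subsetIl.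
  rewrite !orbF; apply/open_nbhP/andP => [[u]|[/open_nbhP[u uSP uv]]].
    rewrite inE => /andP[uSP ku] uv; split; first by apply/open_nbhP; exists u.
    by apply: leq_trans ku _; apply: leq_bigmax_cond; rewrite uSP.
  rewrite ltnNge => /bigmax_leqP H.
  have [/exists_inP[u' /andP[u'S u'v] ku']|] :=
    boolP [exists u' in [pred u | (u \in S :&: P) && e u v], (k < deg e u')%N].
    by exists u'; rewrite // inE u'S.
  rewrite negb_exists_in => /forall_inP H'; case: H => u' u'S.
  by rewrite leqNgt; apply: H'.
(* When [k%:R + lam] is 0, [w k] is only the default inverse and [w] may increase, but then no
   vertex of [P] has level at most [k]. *)
have [k0|k0] := ltP 0 (k%:R + lam); last first.
  rewrite big_pred0 ?mulr0 // => v; apply/negP => /andP[vP vk].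
  have := level_lambda_gt0 vP; rewrite ltNge => /negP; apply.
  by apply: le_trans k0; rewrite lerD2r ler_nat.
apply: mulr_ge0.
  by rewrite subr_ge0 /w lef_pV2 ?posrE // -?natr1; lra.
rewrite pre oppr_ge0.
(* [excess_le] needs a nonempty set; the empty one has charge 0. *)
have [->|U0] := eqVneq U set0.
  rewrite cards0 mulr0 addr0 /excess big_set0 /open_nbh big_set0 cards0.
  by rewrite subrr.
have : lam * #|U|%:R <= lam * #|S :&: P|%:R.
  by rewrite ler_wpM2l // ler_nat subset_leq_card.
have := excess_le US U0; have := lambda_excess; lra.
Qed.

End Component.

(** * Combining the components with the rest of the graph *)

Lemma sum_components_card : (\sum_(P in components e S) #|S :&: P| = #|S|)%N.
Proof.
have -> : #|S| = (\sum_(v in S :|: open_nbh e S | v \in S) 1)%N.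
  rewrite -sum1_card; apply: eq_bigl => v; rewrite inE.
  by case: (v \in S); rewrite ?andbF.
rewrite (set_partition_big_cond _ components_partition).
apply: eq_bigr => P _; rewrite -sum1_card.
by apply: eq_bigl => v; rewrite inE andbC.
Qed.

End Components.
End Graph.

Theorem theorem2 (T : finType) (e : rel T) (S : {set T})
    (e_sym : symmetric e) (e_irr : irreflexive e) (T_gt0 : (0 < #|T|)%N)
    (S_max : max_indep_in e (cheap_set e) S)
    (lambda_ge0 : forall P : {set T}, P \in components e S -> 0 <= lambda e S P) :
  \sum_(P in components e S) \sum_(v in closed_nbh e (S :&: P))
      1 / ((zeta e v)%:R + lambda e S P)
    + \sum_(v in ~: closed_nbh e S) 1 / ((zeta e v)%:R + 1)
  <= (alpha e)%:R :> rat.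
Proof.
have /andP[SC Sind'] := maxsetp S_max.
have S_ind : independent e S.
  (* Independence in the graph induced on the cheap vertices is independence in [e], as [S] consists
     of cheap vertices. *)
  apply/forall_inP => x xS; apply/forall_inP => y yS.
  move/forall_inP: Sind' => /(_ x xS)/forall_inP/(_ y yS).
  by rewrite /induced /= !(subsetP SC).
have [I /andP[IS I_ind] sumI] :=
  exists_independent_zeta e_sym e_irr (~: closed_nbh e S).
have IN v : v \in I -> (v \notin open_nbh e S) && (v \notin S).
  by move/(subsetP IS); rewrite !inE negb_or.
have SI u v : u \in S -> v \in I -> ~~ e u v.
  move=> uS /IN/andP[vN _]; apply: contra vN => uv.
  by apply/open_nbhP; exists u.
have dSI : S :&: I = set0.
  apply/setP => v; rewrite !inE; apply/negP => /andP[vS /IN/andP[_]].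
  by rewrite vS.
have SI_ind : independent e (S :|: I).
  apply/forall_inP => x /setUP[xS|xI]; apply/forall_inP => y /setUP[yS|yI].
  - by move/forall_inP: S_ind => /(_ x xS)/forall_inP/(_ y yS).
  - exact: SI.
  - by rewrite e_sym SI.
  - by move/forall_inP: I_ind => /(_ x xI)/forall_inP/(_ y yI).
have : (#|S| + #|I| <= alpha e)%N.
  by rewrite -cardsUI dSI cards0 addn0 leq_bigmax_cond.
rewrite -(ler_nat rat) natrD; apply: le_trans; apply: lerD => //.
(* Splitting [#|S|] over the components reduces the claim to one component at a time. *)
rewrite -(sum_components_card e_sym S) natr_sum; apply: ler_sum => P PB.
by apply: sum_component_le => //; apply: lambda_ge0.
Qed.
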